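(* Let $K$ be a group, let $(PQR): P\xrightarrow{\bar\jmath}Q\xrightarrow{\bar\phi}R$ be a group extension, let $\theta:Q\to\mathrm{Out}(K)$ be an outer action, and let $(KNP): K\xrightarrow{i_0}N\xrightarrow{\pi_0}P$ be a group extension. Let $(G,j,\pi)$ be an iterated extension of $(KNP)$ by $(PQR)$ whose $Q$-main extension has outer action $\theta$, and put $\phi:=\bar\phi\circ\pi$. Then the isomorphism of groups $$-\star: Z^1(R,Z(K)^P)\xrightarrow{\ \simeq\ }\mathrm{Aut}(KNGQR),\qquad \lambda\mapsto\bigl(g\mapsto\lambda(\phi(g))\cdot g\bigr),$$ induces an isomorphism of groups $$-\star: H^1(R,Z(K)^P)\xrightarrow{\ \simeq\ }\mathrm{Out}(KNGQR;K)\ \subseteq\ \mathrm{Out}_N(G;K).$$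
   Context: Conventions. $Z(A)$ is the centre of a group $A$. For a normal subgroup, $\complement_G(g)$ denotes the inner automorphism $x\mapsto gxg^{-1}$. For a group $H$ and an $H$-module $A$ (written multiplicatively), cochains are normalized (trivial value whenever an argument is the identity); $Z^1(H,A)$ is the group of maps $\lambda$ with $\lambda(h_1h_2)=\lambda(h_1)\cdot{}^{h_1}\lambda(h_2)$, $B^1(H,A)$ is the group of maps $\partial a(h)=a^{-1}\cdot{}^{h}a$ with $a\in A$, and $H^1=Z^1/B^1$. Extensions. An extension of $K$ by $Q$ is a triple $(G,i,\pi)$ with $i:K\to G$ an injective homomorphism, $\pi:G\to Q$ a surjective homomorphism, $i(K)=\mathrm{Ker}(\pi)$; $K$ is identified with $i(K)$ (and likewise for other injections). Conjugation of $G$ on $K$ induces a homomorphism $Q\to\mathrm{Out}(K)=\mathrm{Aut}(K)/\mathrm{Inn}(K)$, the outer action of the extension. Actions. $P$ is regarded as a normal subgroup of $Q$ via $\bar\jmath$. $Q$ acts on $Z(K)$ via $\theta$, and $R$ acts on $Z(K)^P$ by $\theta_0$: ${}^{\theta_0(r)}z={}^{\theta(q)}z$ for any $q\in Q$ with $\bar\phi(q)=r$. Iterated extensions. An iterated extension of $(KNP)$ by $(PQR)$ is a triple $(G,j,\pi)$ with $G$ a group, $j:N\to G$ an injective homomorphism and $\pi:G\to Q$ a surjective homomorphism such that, with $i:=j\circ i_0$ and $\phi:=\bar\phi\circ\pi$, one has $\pi\circ j=\bar\jmath\circ\pi_0$, $j(N)=\mathrm{Ker}(\phi)$ and $i(K)=\mathrm{Ker}(\pi)$.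 Its $Q$-main extension is the extension $(G,i,\pi)$ of $K$ by $Q$. Automorphisms. $\mathrm{Aut}(KNGQR):=\{\xi\in\mathrm{Aut}(G):\xi\circ j=j,\ \pi\circ\xi=\pi\}$. $\mathrm{Aut}_{N,K}(G)$ is the group of automorphisms of $G$ stabilizing both $N$ and $K$; $\complement_G(K)$ is its normal subgroup of inner automorphisms by elements of $K$; $\mathrm{Out}_N(G;K):=\mathrm{Aut}_{N,K}(G)/\complement_G(K)$; $\mathrm{Out}(KNGQR;K)$ is the image of $\mathrm{Aut}(KNGQR)$ in $\mathrm{Out}_N(G;K)$. *)

(* Defs.v *)
From HB Require Import structures.
From mathcomp Require Import all_boot.
From mathcomp Require Import boolp classical_sets.

(* Arbitrary (possibly infinite) groups are [groupType]s. Its choiceType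
   requirement is harmless, as boolp provides a choice operator on any type;
   boolp is also what turns subgroups, given by Prop conditions, into the
   boolean predicates expected by [groupClosed]. *)

Set Implicit Arguments.
Unset Strict Implicit.
Unset Printing Implicit Defensive.

Local Open Scope group_scope.
Local Open Scope quotient_scope.
Local Open Scope classical_set_scope.

Notation hom := UMagmaMorphism.type.

Lemma build_groupClosed (G : groupType) (S : {pred G}) :
  1 \in S -> mulg_closed S -> invg_closed S -> group_closed S.
Proof. by move=> S1 SM SV; split=> // x y xS yS; apply: SM => //; apply: SV. Qed.

HB.factory Record isGroupClosed (G : groupType) (S : {pred G}) := {
  group_closed_subproof : group_closed S
}.
HB.builders Context G S of isGroupClosed G S.
HB.instance Definition _ :=
  isMulClosed.Build G S (group_closedM group_closed_subproof).
HB.instance Definition _ := isMul1Closed.Build G S group_closed_subproof.1.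
HB.instance Definition _ :=
  isInvClosed.Build G S (group_closedV group_closed_subproof).
HB.end.

Section Subgroup.
Variables (G : groupType) (S : groupClosed G).

Record subgroup := Subgroup { sgval : G; sgvalP : sgval \in S }.

HB.instance Definition _ := [isSub for sgval].
HB.instance Definition _ := [Choice of subgroup by <:].

Fact subgroup_closed : group_closed (S : {pred G}).
Proof.
apply: build_groupClosed; [exact: gpred1 | exact: gpredM | exact: gpredVr].
Qed.

HB.instance Definition _ :=
  SubChoice_isSubGroup.Build G (mem S) subgroup subgroup_closed.

End Subgroup.

HB.mixin Record isConjClosed (G : groupType) (S : {pred G}) := {
  gpredJ : forall x y, x \in S -> x ^ y \in S
}.

#[short(type="normalClosed")]
HB.structure Definition NormalClosed G := {S of isConjClosed G S & GroupClosed G S}.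

Section Quotient.
Variables (G : groupType) (H : normalClosed G).

Definition same_coset (x y : G) := x^-1 * y \in H.

Fact same_coset_equiv : equiv_class_of same_coset.
Proof.
split=> [x|x y|y x z]; rewrite /same_coset.
- by rewrite mulVg gpred1.
- by apply/idP/idP => /gpredVr; rewrite invgM invgK.
- by move=> xy yz; rewrite -[x^-1](mulgK y) -mulgA gpredM.
Qed.

Canonical same_coset_equiv_rel := EquivRelPack same_coset_equiv.
Canonical same_coset_encModRel := defaultEncModRel same_coset.

Definition quotient := {eq_quot same_coset}.

HB.instance Definition _ : EqQuotient G same_coset quotient :=
  EqQuotient.on quotient.
HB.instance Definition _ := Choice.on quotient.

Lemma same_cosetE x y : (\pi_quotient x = \pi_quotient y) <-> x^-1 * y \in H.
Proof. by split=> [/eqmodP//|xy]; apply/eqmodP. Qed.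

Definition quo_one : quotient := \pi_quotient 1.
Definition quo_mul (u v : quotient) : quotient := \pi_quotient (repr u * repr v).
Definition quo_inv (u : quotient) : quotient := \pi_quotient (repr u)^-1.

Lemma repr_same_coset x : (repr (\pi_quotient x))^-1 * x \in H.
Proof. by apply/same_cosetE; rewrite reprK. Qed.

Lemma quo_mulE x y : quo_mul (\pi_quotient x) (\pi_quotient y) = \pi_quotient (x * y).
Proof.
apply/same_cosetE; set x' := repr _; set y' := repr _.
have -> : (x' * y')^-1 * (x * y) = (x'^-1 * x) ^ y' * (y'^-1 * y).
  by rewrite /conjg invgM !mulgA mulgK.
by rewrite gpredM ?gpredJ ?repr_same_coset.
Qed.

Lemma quo_invE x : quo_inv (\pi_quotient x) = \pi_quotient x^-1.
Proof.
apply/same_cosetE; set x' := repr _; rewrite invgK.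
have -> : x' * x^-1 = ((x'^-1 * x)^-1) ^ x'^-1.
  by rewrite /conjg invgK invgM invgK -!mulgA mulgV mulg1.
by rewrite gpredJ ?gpredVr ?repr_same_coset.
Qed.

Lemma quoP (u : quotient) : exists x, u = \pi_quotient x.
Proof. by exists (repr u); rewrite reprK. Qed.

Fact quo_mulA : associative quo_mul.
Proof.
by move=> u v w; have [[x ->] [[y ->] [z ->]]] := (quoP u, (quoP v, quoP w));
  rewrite !quo_mulE mulgA.
Qed.
Fact quo_mul1 : left_id quo_one quo_mul.
Proof. by move=> u; have [x ->] := quoP u; rewrite quo_mulE mul1g. Qed.
Fact quo_1mul : right_id quo_one quo_mul.
Proof. by move=> u; have [x ->] := quoP u; rewrite quo_mulE mulg1. Qed.
Fact quo_mulV : left_inverse quo_one quo_inv quo_mul.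
Proof. by move=> u; have [x ->] := quoP u; rewrite quo_invE quo_mulE mulVg. Qed.
Fact quo_Vmul : right_inverse quo_one quo_inv quo_mul.
Proof. by move=> u; have [x ->] := quoP u; rewrite quo_invE quo_mulE mulgV. Qed.

HB.instance Definition _ :=
  isGroup.Build quotient quo_mulA quo_mul1 quo_1mul quo_mulV quo_Vmul.

Definition class_of (x : G) : quotient := \pi_quotient x.

Fact class_of_monoid_morphism : monoid_morphism class_of.
Proof. by split=> // x y; rewrite -[RHS]/(quo_mul _ _) quo_mulE. Qed.
HB.instance Definition _ :=
  isUMagmaMorphism.Build G quotient class_of class_of_monoid_morphism.

Lemma class_ofP x y : class_of x = class_of y <-> x^-1 * y \in H.
Proof. exact: same_cosetE. Qed.

Lemma class_ofK (u : quotient) : class_of (repr u) = u.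
Proof. exact: reprK. Qed.

End Quotient.

Arguments class_of {G} H x.

Section Automorphisms.
Variable G : groupType.

Definition automorphism_pred : pred (G -> G) :=
  fun f => `[< {morph f : x y / x * y} /\ bijective f >].

Record aut := Aut { aut_fun :> G -> G; _ : automorphism_pred aut_fun }.

HB.instance Definition _ := [isSub for aut_fun].
HB.instance Definition _ := [Choice of aut by <:].

Lemma autM (a : aut) : {morph a : x y / x * y}.
Proof. by case: a => f /= /asboolP[]. Qed.
Lemma aut_bij (a : aut) : bijective a.
Proof. by case: a => f /= /asboolP[]. Qed.

Lemma aut1 (a : aut) : a 1 = 1.
Proof. by apply: (mulgI (a 1)); rewrite -autM !mulg1. Qed.
Lemma autV (a : aut) x : a x^-1 = (a x)^-1.
Proof. by apply: (mulgI (a x)); rewrite -autM !mulgV aut1. Qed.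

HB.instance Definition _ (a : aut) :=
  isUMagmaMorphism.Build G G a (aut1 a, @autM a).

Lemma autP (a b : aut) : a =1 b -> a = b.
Proof. by move=> ab; apply/val_inj/funext. Qed.

Fact aut_one_subproof : automorphism_pred id.
Proof. by apply/asboolP; split=> //; exists id. Qed.
Definition aut_one := Aut aut_one_subproof.

Fact aut_mul_subproof (a b : aut) : automorphism_pred (a \o b).
Proof.
apply/asboolP; split=> [x y|] /=; first by rewrite !autM.
by apply: bij_comp; apply: aut_bij.
Qed.
(* The group law of [aut G] is composition: (a * b) x = a (b x). *)
Definition aut_mul a b := Aut (aut_mul_subproof a b).

Lemma aut_surj (a : aut) y : exists x, a x = y.
Proof. by have [g _ K] := aut_bij a; exists (g y). Qed.
Definition aut_inv_fun (a : aut) y := projT1 (cid (aut_surj a y)).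
Lemma aut_inv_funK (a : aut) : cancel (aut_inv_fun a) a.
Proof. by move=> y; rewrite /aut_inv_fun; case: cid. Qed.
Lemma aut_inv_Kfun (a : aut) : cancel a (aut_inv_fun a).
Proof. by move=> y; apply: (bij_inj (aut_bij a)); rewrite aut_inv_funK. Qed.

Fact aut_inv_subproof (a : aut) : automorphism_pred (aut_inv_fun a).
Proof.
apply/asboolP; split=> [x y|]; last first.
  by exists a; [exact: aut_inv_funK | exact: aut_inv_Kfun].
by apply: (bij_inj (aut_bij a)); rewrite autM !aut_inv_funK.
Qed.
Definition aut_inv a := Aut (aut_inv_subproof a).

Fact aut_mulA : associative aut_mul.
Proof. by move=> a b c; apply: autP. Qed.
Fact aut_mul1 : left_id aut_one aut_mul.
Proof. by move=> a; apply: autP. Qed.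
Fact aut_1mul : right_id aut_one aut_mul.
Proof. by move=> a; apply: autP. Qed.
Fact aut_mulV : left_inverse aut_one aut_inv aut_mul.
Proof. by move=> a; apply: autP => x /=; rewrite aut_inv_Kfun. Qed.
Fact aut_Vmul : right_inverse aut_one aut_inv aut_mul.
Proof. by move=> a; apply: autP => x /=; rewrite aut_inv_funK. Qed.

HB.instance Definition _ :=
  isGroup.Build aut aut_mulA aut_mul1 aut_1mul aut_mulV aut_Vmul.

Fact inner_subproof (g : G) : automorphism_pred (fun x => g * x * g^-1).
Proof.
apply/asboolP; split=> [x y|]; first by rewrite !mulgA mulgVK.
by exists (fun x => g^-1 * x * g) => x; rewrite !mulgA ?mulVg ?mulgV mul1g
  -mulgA ?mulVg ?mulgV mulg1.
Qed.
(* Not [conjg]: MathComp's [x ^ g] is g^-1 * x * g. *)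
Definition inner (g : G) : aut := Aut (inner_subproof g).

Fact inner_monoid_morphism : monoid_morphism inner.
Proof.
split=> [|g h]; apply: autP => x /=; first by rewrite invg1 mulg1 mul1g.
by rewrite invgM !mulgA.
Qed.
HB.instance Definition _ :=
  isUMagmaMorphism.Build G aut inner inner_monoid_morphism.

Lemma innerJ (a : aut) g : a * inner g * a^-1 = inner (a g).
Proof.
apply: autP => x; rewrite /= !autM autV; congr (_ * _ * _).
exact: aut_inv_funK.
Qed.

Lemma aut_mulE (a b : aut) x : (a * b) x = a (b x).
Proof. by []. Qed.
Lemma aut_oneE x : (1 : aut) x = x.
Proof. by []. Qed.
Lemma aut_mulVE (a : aut) x : a^-1 (a x) = x.
Proof. exact: aut_inv_Kfun. Qed.
Lemma aut_mulgVE (a : aut) x : a (a^-1 x) = x.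
Proof. exact: aut_inv_funK. Qed.

Definition inner_pred : {pred aut} := fun a => `[< exists g, a = inner g >].

Fact inner_pred_closed : group_closed inner_pred.
Proof.
apply: build_groupClosed.
- by apply/asboolP; exists 1; rewrite gmulf1.
- move=> a b /asboolP[g ->] /asboolP[h ->]; apply/asboolP; exists (g * h).
  by rewrite gmulfM.
- by move=> a /asboolP[g ->]; apply/asboolP; exists g^-1; rewrite gmulfV.
Qed.
HB.instance Definition _ := isGroupClosed.Build aut inner_pred inner_pred_closed.

Fact inner_predJ (a b : aut) : a \in inner_pred -> a ^ b \in inner_pred.
Proof.
move=> /asboolP[g ->]; apply/asboolP; exists (b^-1 g).
by rewrite -innerJ invgK /conjg mulgA.
Qed.
HB.instance Definition _ := isConjClosed.Build aut inner_pred inner_predJ.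

Definition out := quotient inner_pred.
HB.instance Definition _ := Group.on out.

End Automorphisms.

Arguments inner_pred G a : clear implicits.

Section Center.
Variable K : groupType.

Definition center : {pred K} := fun z => `[< forall x, commute z x >].

Fact center_closed : group_closed center.
Proof.
apply: build_groupClosed.
- by apply/asboolP => x; rewrite /commute mulg1 mul1g.
- move=> y z /asboolP yC /asboolP zC; apply/asboolP => x.
  by rewrite /commute -mulgA (zC x) mulgA (yC x) mulgA.
- move=> z /asboolP zC; apply/asboolP => x; apply: (mulgI z).
  by rewrite !mulgA mulgV mul1g (zC x) mulgK.
Qed.
HB.instance Definition _ := isGroupClosed.Build K center center_closed.

Definition Z := subgroup center.
HB.instance Definition _ := Group.on Z.
HB.instance Definition _ := SubGroup.on Z.

Lemma aut_center (a : aut K) z : z \in center -> a z \in center.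
Proof.
move=> /asboolP zC; apply/asboolP => x.
by rewrite -(aut_mulgVE a x) /commute -!autM zC.
Qed.

End Center.

(* [mod_comm] makes the multiplicatively written group A abelian. *)
Record gmodule (H A : groupType) := GModule {
  act :> H -> A -> A;
  mod_comm : commutative (@mul A);
  actM_mod : forall h, {morph act h : a b / a * b};
  act1 : forall a, act 1 a = a;
  actM : forall h k a, act (h * k) a = act h (act k a)
}.

Section ModuleTheory.
Variables (H A : groupType) (M : gmodule H A).

Lemma act_1 h : M h 1 = 1.
Proof. by apply: (mulgI (M h 1)); rewrite -actM_mod !mulg1. Qed.
Lemma act_V h a : M h a^-1 = (M h a)^-1.
Proof. by apply: (mulgI (M h a)); rewrite -actM_mod !mulgV act_1. Qed.

Lemma mod_mulACA (a b c d : A) : (a * b) * (c * d) = (a * c) * (b * d).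
Proof. by rewrite -!mulgA; congr (_ * _); rewrite !mulgA (mod_comm M b). Qed.

End ModuleTheory.

Section Cohomology.
Variables (H A : groupType) (M : gmodule H A).

Definition cocycle_pred : pred (H -> A) := fun l =>
  `[< l 1 = 1 /\ forall h1 h2, l (h1 * h2) = l h1 * M h1 (l h2) >].

Record Z1 := Cocycle { cocycle_fun :> H -> A; _ : cocycle_pred cocycle_fun }.

HB.instance Definition _ := [isSub for cocycle_fun].
HB.instance Definition _ := [Choice of Z1 by <:].

Lemma cocycle1 (l : Z1) : l 1 = 1.
Proof. by case: l => l /= /asboolP[]. Qed.
Lemma cocycleM (l : Z1) h1 h2 : l (h1 * h2) = l h1 * M h1 (l h2).
Proof. by case: l => l /= /asboolP[]. Qed.
Lemma cocycleP (l m : Z1) : l =1 m -> l = m.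
Proof. by move=> lm; apply/val_inj/funext. Qed.

Fact Z1_one_subproof : cocycle_pred (fun=> 1).
Proof. by apply/asboolP; split=> // h _; rewrite act_1 mulg1. Qed.
Definition Z1_one := Cocycle Z1_one_subproof.

Fact Z1_mul_subproof (l m : Z1) : cocycle_pred (fun h => l h * m h).
Proof.
apply/asboolP; split=> [|h1 h2]; first by rewrite !cocycle1 mulg1.
by rewrite !cocycleM (actM_mod M) (mod_mulACA M).
Qed.
Definition Z1_mul l m := Cocycle (Z1_mul_subproof l m).

Fact Z1_inv_subproof (l : Z1) : cocycle_pred (fun h => (l h)^-1).
Proof.
apply/asboolP; split=> [|h1 h2]; first by rewrite cocycle1 invg1.
by rewrite cocycleM invgM (mod_comm M) act_V.
Qed.
Definition Z1_inv l := Cocycle (Z1_inv_subproof l).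

Fact Z1_mulA : associative Z1_mul.
Proof. by move=> l m n; apply: cocycleP => h; exact: mulgA. Qed.
Fact Z1_mul1 : left_id Z1_one Z1_mul.
Proof. by move=> l; apply: cocycleP => h; exact: mul1g. Qed.
Fact Z1_1mul : right_id Z1_one Z1_mul.
Proof. by move=> l; apply: cocycleP => h; exact: mulg1. Qed.
Fact Z1_mulV : left_inverse Z1_one Z1_inv Z1_mul.
Proof. by move=> l; apply: cocycleP => h; exact: mulVg. Qed.
Fact Z1_Vmul : right_inverse Z1_one Z1_inv Z1_mul.
Proof. by move=> l; apply: cocycleP => h; exact: mulgV. Qed.

HB.instance Definition _ :=
  isGroup.Build Z1 Z1_mulA Z1_mul1 Z1_1mul Z1_mulV Z1_Vmul.

Definition B1 : {pred Z1} := fun l =>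
  `[< exists a : A, forall h, l h = a^-1 * M h a >].

Fact B1_closed : group_closed B1.
Proof.
apply: build_groupClosed.
- by apply/asboolP; exists 1 => h; rewrite act_1 mulg1 invg1.
- move=> l m /asboolP[a la] /asboolP[b mb]; apply/asboolP; exists (a * b) => h.
  rewrite [LHS]/= la mb (actM_mod M) (mod_mulACA M) invgM.
  by rewrite (mod_comm M a^-1).
- move=> l /asboolP[a la]; apply/asboolP; exists a^-1 => h.
  by rewrite [LHS]/= la act_V invgM invgK (mod_comm M).
Qed.
HB.instance Definition _ := isGroupClosed.Build Z1 B1 B1_closed.

Fact B1_J (l m : Z1) : l \in B1 -> l ^ m \in B1.
Proof.
suff -> : l ^ m = l by [].
by apply: cocycleP => h; rewrite /= (mod_comm M (l h)) mulgA mulVg mul1g.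
Qed.
HB.instance Definition _ := isConjClosed.Build Z1 B1 B1_J.

Definition H1 := quotient B1.
HB.instance Definition _ := Group.on H1.

End Cohomology.

Arguments B1 {H A} M l.

Record extension (K G Q : groupType) := Extension {
  ext_inj : hom K G;
  ext_proj : hom G Q;
  ext_injective : injective ext_inj;
  ext_surjective : forall q, exists g, ext_proj g = q;
  ext_exact : forall g, (exists k, ext_inj k = g) <-> ext_proj g = 1
}.

Section OuterAction.
Variables (K G Q : groupType) (E : extension K G Q).
Local Notation i := (ext_inj E).
Local Notation pi := (ext_proj E).

Lemma ext_projK k : pi (i k) = 1.
Proof. by apply/ext_exact; exists k. Qed.

Lemma ext_conj_ex g k : exists k', i k' = g * i k * g^-1.
Proof. by apply/ext_exact; rewrite !gmulfM ext_projK mulg1 gmulfV mulgV. Qed.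

Definition ext_conj_fun g k := projT1 (cid (ext_conj_ex g k)).

Lemma ext_conj_funE g k : i (ext_conj_fun g k) = g * i k * g^-1.
Proof. by rewrite /ext_conj_fun; case: cid. Qed.

Fact ext_conj_subproof g : automorphism_pred (ext_conj_fun g).
Proof.
have inj := @ext_injective _ _ _ E.
apply/asboolP; split=> [x y|].
  by apply: inj; rewrite gmulfM !ext_conj_funE gmulfM !mulgA mulgVK.
exists (ext_conj_fun g^-1) => x; apply: inj; rewrite !ext_conj_funE.
  by rewrite invgK !mulgA mulVg mul1g mulgVK.
by rewrite invgK !mulgA mulgV mul1g mulgK.
Qed.

Definition ext_conj g : aut K := Aut (ext_conj_subproof g).

Lemma ext_conjE g k : i (ext_conj g k) = g * i k * g^-1.
Proof. exact: ext_conj_funE. Qed.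

Lemma ext_conjM g h : ext_conj (g * h) = ext_conj g * ext_conj h.
Proof.
apply: autP => k; apply: (@ext_injective _ _ _ E).
by rewrite aut_mulE !ext_conjE invgM !mulgA.
Qed.

Lemma ext_conj_inj k : ext_conj (i k) = inner k.
Proof.
apply: autP => x; apply: (@ext_injective _ _ _ E).
by rewrite ext_conjE /= !gmulfM gmulfV.
Qed.

Definition ext_section q : G := projT1 (cid (ext_surjective E q)).

Lemma ext_sectionK : cancel ext_section pi.
Proof. by move=> q; rewrite /ext_section; case: cid. Qed.

(* The class does not depend on the preimage of q: see [outer_actionE]. *)
Definition outer_action_fun (q : Q) : out K :=
  class_of (inner_pred K) (ext_conj (ext_section q)).

Lemma outer_action_funE g :
  outer_action_fun (pi g) = class_of (inner_pred K) (ext_conj g).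
Proof.
set g' := ext_section (pi g).
have [k ik] : exists k, i k = g'^-1 * g.
  by apply/ext_exact; rewrite gmulfM gmulfV ext_sectionK mulVg.
have -> : ext_conj g = ext_conj g' * inner k.
  by rewrite -ext_conj_inj -ext_conjM ik mulVKg.
by apply/class_ofP; rewrite mulKg; apply/asboolP; exists k.
Qed.

Fact outer_action_monoid_morphism : monoid_morphism outer_action_fun.
Proof.
have funM q q' : outer_action_fun (q * q') =
    outer_action_fun q * outer_action_fun q'.
  rewrite -[q]ext_sectionK -[q']ext_sectionK -gmulfM !outer_action_funE.
  by rewrite ext_conjM gmulfM.
by split=> //; apply: (mulgI (outer_action_fun 1)); rewrite -funM !mulg1.
Qed.
HB.instance Definition _ := isUMagmaMorphism.Build Q (out K)
  outer_action_fun outer_action_monoid_morphism.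

Definition outer_action : hom Q (out K) := outer_action_fun.

Lemma outer_actionE g :
  outer_action (pi g) = class_of (inner_pred K) (ext_conj g).
Proof. exact: outer_action_funE. Qed.

End OuterAction.

Section CenterModule.
Variables (K Q : groupType) (theta : hom Q (out K)).

(* The choice of a representative of [theta q] is immaterial on the centre:
   see [center_actE]. *)
Definition center_act (q : Q) (z : Z K) : Z K :=
  Subgroup (aut_center (repr (theta q)) (sgvalP z)).

Lemma center_actE q (a : aut K) (z : Z K) :
  theta q = class_of (inner_pred K) a -> sgval (center_act q z) = a (sgval z).
Proof.
rewrite /center_act => /=; set b := repr (theta q) => qa.
have : class_of (inner_pred K) b = class_of (inner_pred K) a.
  by rewrite -qa /b /class_of reprK.
move=> /class_ofP /asboolP[k bak].
have -> : a = b * inner k by rewrite -bak mulVKg.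
rewrite aut_mulE /=; congr (b _).
by have /asboolP/(_ k)<- := sgvalP z; rewrite mulgK.
Qed.

Fact Z_comm : commutative (@mul (Z K)).
Proof.
by move=> x y; apply: val_inj; have /asboolP/(_ (sgval y)) := sgvalP x.
Qed.

Fact center_actM_mod q : {morph center_act q : x y / x * y}.
Proof. by move=> x y; apply: val_inj; exact: autM. Qed.

Fact center_act1 z : center_act 1 z = z.
Proof. by apply: val_inj; apply: (@center_actE 1 1); rewrite !gmulf1. Qed.

Fact center_actM q q' z :
  center_act (q * q') z = center_act q (center_act q' z).
Proof.
apply: val_inj; apply: (@center_actE _ (repr (theta q) * repr (theta q'))).
by rewrite !gmulfM /= !class_ofK.
Qed.

Definition center_module : gmodule Q (Z K) :=
  GModule Z_comm center_actM_mod center_act1 center_actM.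

End CenterModule.

Section Invariants.
Variables (P Q R A : groupType) (PQR : extension P Q R) (M : gmodule Q A).

Definition invariant_pred : {pred A} := fun a =>
  `[< forall p, M (ext_inj PQR p) a = a >].

Fact invariant_closed : group_closed invariant_pred.
Proof.
apply: build_groupClosed.
- by apply/asboolP => p; rewrite act_1.
- move=> a b /asboolP aP /asboolP bP; apply/asboolP => p.
  by rewrite actM_mod aP bP.
- by move=> a /asboolP aP; apply/asboolP => p; rewrite act_V aP.
Qed.
HB.instance Definition _ := isGroupClosed.Build A invariant_pred invariant_closed.

Definition invariants := subgroup invariant_pred.
HB.instance Definition _ := Group.on invariants.
HB.instance Definition _ := SubGroup.on invariants.

Lemma invariant_act q a : a \in invariant_pred -> M q a \in invariant_pred.
Proof.
move=> /asboolP aP; apply/asboolP => p.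
have [p' pp'] : exists p', ext_inj PQR p' = q^-1 * ext_inj PQR p * q.
  by apply/ext_exact; rewrite !gmulfM ext_projK mulg1 gmulfV mulVg.
by rewrite -actM -[in RHS](aP p') -actM pp' !mulgA mulgV mul1g.
Qed.

(* Any preimage of r in Q can be used in place of the chosen one: see
   [invariant_act_funE]. *)
Definition invariant_act_fun (r : R) (a : invariants) : invariants :=
  Subgroup (invariant_act (ext_section PQR r) (sgvalP a)).

Lemma invariant_act_funE q (a : invariants) :
  sgval (invariant_act_fun (ext_proj PQR q) a) = M q (sgval a).
Proof.
rewrite /=; set q' := ext_section _ _.
have [p pq] : exists p, ext_inj PQR p = q'^-1 * q.
  by apply/ext_exact; rewrite gmulfM gmulfV ext_sectionK mulVg.
have /asboolP/(_ p) aP := sgvalP a.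
by rewrite -[in LHS]aP -actM pq mulVKg.
Qed.

Fact invariant_comm : commutative (@mul invariants).
Proof. by move=> a b; apply: val_inj; exact: (mod_comm M). Qed.

Fact invariant_actM_mod r : {morph invariant_act_fun r : a b / a * b}.
Proof. by move=> a b; apply: val_inj; exact: (actM_mod M). Qed.

Fact invariant_act1 a : invariant_act_fun 1 a = a.
Proof.
by apply: val_inj; rewrite -[1](gmulf1 (s := ext_proj PQR)) [LHS]invariant_act_funE act1.
Qed.

Fact invariant_actM r r' a :
  invariant_act_fun (r * r') a = invariant_act_fun r (invariant_act_fun r' a).
Proof.
apply: val_inj.
rewrite -{1}(ext_sectionK PQR r) -{1}(ext_sectionK PQR r') -gmulfM.
by rewrite [LHS]invariant_act_funE actM.
Qed.

Definition invariant_module : gmodule R invariants :=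
  GModule invariant_comm invariant_actM_mod invariant_act1 invariant_actM.

End Invariants.

(* R acting on Z(K)^P; elements of [invariants] project to K by [sgval] twice. *)
Definition Z_K_P_module (K P Q R : groupType) (theta : hom Q (out K))
    (PQR : extension P Q R) : gmodule R (invariants PQR (center_module theta)) :=
  invariant_module PQR (center_module theta).

Record iterated_extension (K N P Q R : groupType)
    (KNP : extension K N P) (PQR : extension P Q R) (G : groupType) :=
  IteratedExtension {
  it_inj : hom N G;
  it_proj : hom G Q;
  it_injective : injective it_inj;
  it_surjective : forall q, exists g, it_proj g = q;
  it_comm : forall n, it_proj (it_inj n) = ext_inj PQR (ext_proj KNP n);
  it_ker_phi : forall g,
    (exists n, it_inj n = g) <-> ext_proj PQR (it_proj g) = 1;
  it_ker_pi : forall g,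
    (exists k, it_inj (ext_inj KNP k) = g) <-> it_proj g = 1
}.

Section IteratedExtension.
Variables (K N P Q R : groupType) (KNP : extension K N P).
Variables (PQR : extension P Q R) (G : groupType).
Variable E : iterated_extension KNP PQR G.

Local Notation j := (it_inj E).

Definition it_i : hom K G := it_inj E \o ext_inj KNP.
Definition it_phi : hom G R := ext_proj PQR \o it_proj E.

Fact it_i_injective : injective it_i.
Proof. exact: inj_comp (@it_injective _ _ _ _ _ _ _ _ E) (@ext_injective _ _ _ KNP). Qed.

Definition Q_main : extension K G Q :=
  Extension it_i_injective (it_surjective E) (it_ker_pi E).

Definition Aut_KNGQR_pred : {pred aut G} := fun xi =>
  `[< (forall n, xi (j n) = j n) /\
      (forall g, it_proj E (xi g) = it_proj E g) >].

Fact Aut_KNGQR_closed : group_closed Aut_KNGQR_pred.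
Proof.
apply: build_groupClosed.
- by apply/asboolP.
- move=> a b /asboolP[aj ap] /asboolP[bj bp]; apply/asboolP.
  by split=> x; rewrite aut_mulE ?bj ?aj // ap bp.
- move=> a /asboolP[aj ap]; apply/asboolP; split=> x.
    by rewrite -{1}aj aut_mulVE.
  by rewrite -ap aut_mulgVE.
Qed.
HB.instance Definition _ :=
  isGroupClosed.Build (aut G) Aut_KNGQR_pred Aut_KNGQR_closed.

Definition Aut_KNGQR := subgroup Aut_KNGQR_pred.
HB.instance Definition _ := Group.on Aut_KNGQR.
HB.instance Definition _ := SubGroup.on Aut_KNGQR.

Definition stabilizer_pred : {pred aut G} := fun xi =>
  `[< xi @` range j = range j /\ xi @` range it_i = range it_i >].

Fact stabilizer_closed : group_closed stabilizer_pred.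
Proof.
have imM (a b : aut G) (A : set G) : (a * b) @` A = a @` (b @` A).
  by rewrite -image_comp.
have im1 (A : set G) : (1 : aut G) @` A = A by exact: image_id.
apply: build_groupClosed.
- by apply/asboolP; rewrite !im1.
- move=> a b /asboolP[aj ai] /asboolP[bj bi]; apply/asboolP.
  by rewrite !imM bj bi.
- move=> a /asboolP[aj ai]; apply/asboolP.
  by split; [rewrite -{1}aj | rewrite -{1}ai]; rewrite -imM mulVg im1.
Qed.
HB.instance Definition _ :=
  isGroupClosed.Build (aut G) stabilizer_pred stabilizer_closed.

Definition Aut_NK := subgroup stabilizer_pred.
HB.instance Definition _ := Group.on Aut_NK.
HB.instance Definition _ := SubGroup.on Aut_NK.

Definition inner_K : {pred Aut_NK} := fun xi =>
  `[< exists k, sgval xi = inner (it_i k) >].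

Fact inner_K_closed : group_closed inner_K.
Proof.
apply: build_groupClosed.
- by apply/asboolP; exists 1; rewrite !gmulf1.
- move=> a b /asboolP[k ak] /asboolP[l bl]; apply/asboolP; exists (k * l).
  by have -> : sgval (a * b) = sgval a * sgval b by []; rewrite ak bl !gmulfM.
- move=> a /asboolP[k ak]; apply/asboolP; exists k^-1.
  by have -> : sgval a^-1 = (sgval a)^-1 by []; rewrite ak !gmulfV.
Qed.
HB.instance Definition _ := isGroupClosed.Build Aut_NK inner_K inner_K_closed.

Fact inner_KJ (a b : Aut_NK) : a \in inner_K -> a ^ b \in inner_K.
Proof.
move=> /asboolP[k ak]; apply/asboolP.
have /asboolP[_ bK] : (sgval b^-1) \in stabilizer_pred by exact: sgvalP.
have [k' _ bk] : range it_i (sgval b^-1 (it_i k)).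
  by rewrite -bK; exists (it_i k) => //; exists k.
exists k'; rewrite bk -innerJ -ak.
have -> : sgval (a ^ b) = (sgval b)^-1 * (sgval a * sgval b) by [].
have -> : sgval b^-1 = (sgval b)^-1 by [].
by rewrite invgK mulgA.
Qed.
HB.instance Definition _ := isConjClosed.Build Aut_NK inner_K inner_KJ.

Definition Out_N_K := quotient inner_K.
HB.instance Definition _ := Group.on Out_N_K.

Lemma Aut_KNGQR_stabilizer (xi : Aut_KNGQR) : sgval xi \in stabilizer_pred.
Proof.
have /asboolP[xij _] := sgvalP xi; apply/asboolP; split.
  by rewrite image_comp; apply: eq_imagel => n _; exact: xij.
by rewrite image_comp; apply: eq_imagel => k _; exact: xij.
Qed.

Definition Aut_KNGQR_incl (xi : Aut_KNGQR) : Aut_NK :=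
  Subgroup (Aut_KNGQR_stabilizer xi).

Fact Aut_KNGQR_incl_monoid_morphism : monoid_morphism Aut_KNGQR_incl.
Proof. by split=> [|x y]; apply: val_inj. Qed.
HB.instance Definition _ := isUMagmaMorphism.Build Aut_KNGQR Aut_NK
  Aut_KNGQR_incl Aut_KNGQR_incl_monoid_morphism.

(* The image of Aut(KNGQR) in Out_N(G;K). *)
Definition Out_KNGQR_pred : {pred Out_N_K} := fun u =>
  `[< exists xi : Aut_KNGQR, u = class_of inner_K (Aut_KNGQR_incl xi) >].

Fact Out_KNGQR_closed : group_closed Out_KNGQR_pred.
Proof.
apply: build_groupClosed.
- by apply/asboolP; exists 1; rewrite !gmulf1.
- move=> u v /asboolP[x ->] /asboolP[y ->]; apply/asboolP; exists (x * y).
  by rewrite !gmulfM.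
- by move=> u /asboolP[x ->]; apply/asboolP; exists x^-1; rewrite !gmulfV.
Qed.
HB.instance Definition _ :=
  isGroupClosed.Build Out_N_K Out_KNGQR_pred Out_KNGQR_closed.

Definition Out_KNGQR := subgroup Out_KNGQR_pred.
HB.instance Definition _ := Group.on Out_KNGQR.
HB.instance Definition _ := SubGroup.on Out_KNGQR.

End IteratedExtension.

Arguments inner_K {K N P Q R KNP PQR G} E xi.

(* Main.v *)
From HB Require Import structures.
Require Import Defs.
From mathcomp Require Import all_boot.
From mathcomp Require Import boolp.

Set Implicit Arguments.
Unset Strict Implicit.
Unset Printing Implicit Defensive.

Local Open Scope group_scope.

(** Everything rests on one description of the coefficient module. Write i, j,
    pi, phi for the maps of the iterated extension. Since G acts on i(K) by
    conjugation through theta, the subgroup i(Z(K)^P) of G consists of the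
    elements of i(K) that commute with j(N) ([invariant_in_GP]), and R acts
    on it by conjugation with lifts to G ([invariant_in_G_act]).

    With this, an automorphism xi of G fixing j(N) pointwise and inducing the
    identity on Q is governed by the displacement xi(g) g^-1. It lies in
    Ker(pi) = i(K), it commutes with j(N) because g and xi(g) conjugate j(N) in
    the same way, and it depends only on the coset g j(N), hence on phi(g). So
    it is a map R -> Z(K)^P, and multiplicativity of xi is exactly the cocycle
    identity; this gives the bijection [star_bijective].

    The coboundary of a is the displacement of conjugation by a^-1. Conversely,
    if conjugation by i(k) fixes j(N) then i(k) commutes with j(N), so k
    already lies in Z(K)^P. Therefore the cocycles whose automorphism is
    conjugation by an element of K are precisely the coboundaries
    ([star_inner]), and the isomorphism passes to the quotients. *)

(** * Group homomorphisms *)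

Lemma inj_surj_bijective (A B : Type) (f : A -> B) :
  injective f -> (forall y, exists x, f x = y) -> bijective f.
Proof.
move=> f_inj f_surj; pose g y := projT1 (cid (f_surj y)).
have gK : cancel g f by move=> y; rewrite /g; case: cid.
by exists g => // x; apply: f_inj; rewrite gK.
Qed.

Section FirstIsomorphism.
Variables (A B : groupType) (S : normalClosed A) (f : hom A B).
Variable ker_f : forall x, f x = 1 <-> x \in S.

Definition quotient_map (u : quotient S) : B := f (repr u).

Lemma quotient_mapE x : quotient_map (class_of S x) = f x.
Proof.
have : (repr (class_of S x))^-1 * x \in S by apply/class_ofP; rewrite class_ofK.
move=> /ker_f; rewrite gmulfM gmulfV => fx.
by apply: (mulgI (f (repr (class_of S x)))^-1); rewrite fx mulVg.
Qed.

Fact quotient_map_monoid_morphism : monoid_morphism quotient_map.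
Proof.
split=> [|u v]; first by rewrite -[1](gmulf1 (s := class_of S)) quotient_mapE gmulf1.
by rewrite -[u]class_ofK -[v]class_ofK -gmulfM !quotient_mapE gmulfM.
Qed.
HB.instance Definition _ := isUMagmaMorphism.Build (quotient S) B
  quotient_map quotient_map_monoid_morphism.

Lemma quotient_map_bijective :
  (forall y, exists x, f x = y) -> bijective quotient_map.
Proof.
move=> f_surj; apply: inj_surj_bijective => [u v|y].
  rewrite -[u]class_ofK -[v]class_ofK !quotient_mapE => uv.
  by apply/class_ofP/ker_f; rewrite gmulfM gmulfV uv mulVg.
by have [x <-] := f_surj y; exists (class_of S x); rewrite quotient_mapE.
Qed.

Lemma first_isomorphism :
  (forall y, exists x, f x = y) ->
  exists fbar : hom (quotient S) B,
    bijective fbar /\ forall x, fbar (class_of S x) = f x.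
Proof.
move=> /quotient_map_bijective f_bij.
by exists quotient_map; split=> // x; exact: quotient_mapE.
Qed.

End FirstIsomorphism.

(** * The projection onto outer automorphisms *)

Section AutToOut.
Variables (K N P Q R : groupType) (KNP : extension K N P).
Variables (PQR : extension P Q R) (G : groupType).
Variable E : iterated_extension KNP PQR G.

Fact Out_class_subproof (xi : Aut_KNGQR E) :
  class_of (inner_K E) (Aut_KNGQR_incl xi) \in Out_KNGQR_pred (E := E).
Proof. by apply/asboolP; exists xi. Qed.

Definition Out_class (xi : Aut_KNGQR E) : Out_KNGQR E :=
  Subgroup (Out_class_subproof xi).

Fact Out_class_monoid_morphism : monoid_morphism Out_class.
Proof. by split=> [|x y]; apply: val_inj; rewrite /= ?gmulf1 ?gmulfM. Qed.
HB.instance Definition _ := isUMagmaMorphism.Build (Aut_KNGQR E) (Out_KNGQR E)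
  Out_class Out_class_monoid_morphism.

Lemma Out_class_surjective u : exists xi, Out_class xi = u.
Proof.
by have /asboolP[xi uxi] := sgvalP u; exists xi; apply: val_inj; rewrite /= uxi.
Qed.

Lemma Out_class_eq1 xi :
  Out_class xi = 1 <-> exists k, sgval xi = inner (it_i E k).
Proof.
have -> : Out_class xi = 1 <-> class_of (inner_K E) (Aut_KNGQR_incl xi) =
    class_of (inner_K E) 1.
  by rewrite gmulf1; split=> [/(congr1 (@sgval _ _))//|xi1]; apply: val_inj.
split=> [/esym/class_ofP|[k xik]].
  by rewrite invg1 mul1g => /asboolP.
by apply/esym/class_ofP; rewrite invg1 mul1g; apply/asboolP; exists k.
Qed.

End AutToOut.

(** * The module of invariants as a subgroup of G *)

Section Star.
Variables (K N P Q R : groupType) (PQR : extension P Q R).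
Variables (theta : hom Q (out K)) (KNP : extension K N P).
Variables (G : groupType) (E : iterated_extension KNP PQR G).
Variable E_theta : outer_action (Q_main E) =1 theta.

Local Notation i := (it_i E).
Local Notation j := (it_inj E).
Local Notation pi := (it_proj E).
Local Notation phi := (it_phi E).
Local Notation M := (Z_K_P_module theta PQR).

Definition invariant_in_G (a : invariants PQR (center_module theta)) : G :=
  i (sgval (sgval a)).
Local Notation v := invariant_in_G.

Fact invariant_in_G_monoid_morphism : monoid_morphism v.
Proof. by split=> [|a b]; rewrite /v /= ?gmulf1 ?gmulfM. Qed.
HB.instance Definition _ := isUMagmaMorphism.Build _ G
  invariant_in_G invariant_in_G_monoid_morphism.

Lemma invariant_in_G_inj : injective v.
Proof. by move=> a b /it_i_injective ab; apply/val_inj/val_inj. Qed.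

Lemma invariant_in_GM : {morph v : a b / a * b}.
Proof. exact: gmulfM. Qed.

Lemma invariant_in_GV : {morph v : a / a^-1}.
Proof. exact: gmulfV. Qed.

Lemma it_phiM : {morph phi : g h / g * h}.
Proof. exact: gmulfM. Qed.

Lemma it_phiV : {morph phi : g / g^-1}.
Proof. exact: gmulfV. Qed.

Lemma it_proj_i k : pi (i k) = 1.
Proof. exact: (ext_projK (Q_main E) k). Qed.

Lemma it_phi_j n : phi (j n) = 1.
Proof. by apply/(it_ker_phi E); exists n. Qed.

Lemma it_phi_i k : phi (i k) = 1.
Proof. exact: it_phi_j. Qed.

Lemma it_phi_surjective r : exists g, phi g = r.
Proof.
have [q <-] := ext_surjective PQR r; have [g <-] := it_surjective E q.
by exists g.
Qed.

(** Conjugation by g realizes the outer automorphism theta (pi g), and all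
    representatives of an outer automorphism agree on the centre. *)
Lemma center_act_conj g z :
  i (sgval (center_act theta (pi g) z)) = g * i (sgval z) * g^-1.
Proof.
have E_g : theta (pi g) = class_of (inner_pred K) (ext_conj (Q_main E) g).
  by rewrite -(outer_actionE (Q_main E)) E_theta.
by rewrite (center_actE z E_g); exact: (ext_conjE (Q_main E)).
Qed.

Lemma invariant_in_G_act g a : v (M (phi g) a) = g * v a * g^-1.
Proof.
rewrite -center_act_conj; congr (i (sgval _)).
exact: (invariant_act_funE (M := center_module theta)).
Qed.

(** Commuting with i(K), contained in j(N), is centrality in K; on central
    elements, conjugation by j(n) is the action of pi_0(n), and every element
    of P is of this form. *)
Lemma invariant_in_GP k :
  (exists a, v a = i k) <-> (forall n, commute (i k) (j n)).
Proof.
split=> [[a <-] n|kC].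
  have := invariant_in_G_act (j n) a.
  by rewrite it_phi_j act1 => va; rewrite /commute {1}va mulgVK.
have kZ : k \in center (K := K).
  apply/asboolP => x; apply: (@it_i_injective _ _ _ _ _ _ _ _ E).
  by rewrite !gmulfM; exact: kC.
pose z : Z K := Subgroup kZ.
have zP : z \in invariant_pred PQR (center_module theta).
  apply/asboolP => p; have [n <-] := ext_surjective KNP p.
  apply/val_inj/(@it_i_injective _ _ _ _ _ _ _ _ E).
  by rewrite -(it_comm E) center_act_conj /= -(kC n) mulgK.
by exists (Subgroup zP).
Qed.

(** * From cocycles to automorphisms *)

Definition twist (l : Z1 M) (g : G) : G := v (l (phi g)) * g.

Lemma it_phi_twist l g : phi (twist l g) = phi g.
Proof. by rewrite it_phiM it_phi_i mul1g. Qed.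

Lemma twistM l : {morph twist l : g h / g * h}.
Proof.
move=> g h; rewrite /twist it_phiM cocycleM invariant_in_GM invariant_in_G_act.
by rewrite !mulgA mulgVK.
Qed.

Lemma twist_mul l m g : twist (l * m) g = twist l (twist m g).
Proof. by rewrite /twist -/(twist m g) it_phi_twist /twist mulgA -invariant_in_GM. Qed.

Lemma twist1 g : twist 1 g = g.
Proof. by rewrite /twist gmulf1 mul1g. Qed.

Fact twist_subproof l : automorphism_pred (twist l).
Proof.
apply/asboolP; split; first exact: twistM.
by exists (twist l^-1) => g; rewrite -twist_mul ?mulVg ?mulgV twist1.
Qed.
Definition twist_aut l : aut G := Aut (twist_subproof l).

Fact twist_aut_subproof l : twist_aut l \in Aut_KNGQR_pred E.
Proof.
apply/asboolP; split=> [n|g] /=.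
  by rewrite /twist it_phi_j cocycle1 gmulf1 mul1g.
by rewrite gmulfM it_proj_i mul1g.
Qed.
Definition star l : Aut_KNGQR E := Subgroup (twist_aut_subproof l).

Fact star_monoid_morphism : monoid_morphism star.
Proof.
split=> [|l m]; apply/val_inj/autP => g /=; first exact: twist1.
exact: twist_mul.
Qed.
HB.instance Definition _ := isUMagmaMorphism.Build (Z1 M) (Aut_KNGQR E)
  star star_monoid_morphism.

Lemma star_injective : injective star.
Proof.
move=> l m lm; apply: cocycleP => r; have [g <-] := it_phi_surjective r.
apply/invariant_in_G_inj/(mulIg g).
by have /(congr1 (fun xi : Aut_KNGQR E => sgval xi g)) := lm.
Qed.

(** * From automorphisms to cocycles *)

(** xi g and g conjugate the normal subgroup j(N) in the same way, so the
    quotient xi g * g^-1 centralizes it. *)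
Lemma displacement_invariant (xi : Aut_KNGQR E) g :
  exists a, v a = sgval xi g * g^-1.
Proof.
have /asboolP[xij xipi] := sgvalP xi.
have [k ik] : exists k, i k = sgval xi g * g^-1.
  by apply/(it_ker_pi E); rewrite gmulfM gmulfV xipi mulgV.
rewrite -ik; apply/invariant_in_GP => n; rewrite ik.
have [n' jn'] : exists n', j n' = g^-1 * j n * g.
  apply/(it_ker_phi E); rewrite -[LHS]/(phi _).
  by rewrite !it_phiM it_phi_j mulg1 it_phiV mulVg.
have jn : j n = g * j n' * g^-1 by rewrite jn' !mulgA mulgV mul1g mulgK.
have xijn : j n = sgval xi g * j n' * (sgval xi g)^-1.
  by rewrite -[in LHS]xij jn !autM autV xij.
by rewrite /commute [in RHS]xijn jn !mulgA !mulgVK.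
Qed.

Lemma displacement_phi (xi : Aut_KNGQR E) g h :
  phi g = phi h -> sgval xi g * g^-1 = sgval xi h * h^-1.
Proof.
move=> gh; have /asboolP[xij _] := sgvalP xi.
have [n jn] : exists n, j n = g^-1 * h.
  apply/(it_ker_phi E); rewrite -[LHS]/(phi _).
  by rewrite it_phiM it_phiV gh mulVg.
have -> : h = g * j n by rewrite jn mulVKg.
by rewrite autM xij invgM mulgA mulgK.
Qed.

Lemma star_surjective (xi : Aut_KNGQR E) : exists l, star l = xi.
Proof.
have l_ex r : exists a, forall g, phi g = r -> v a = sgval xi g * g^-1.
  have [h <-] := it_phi_surjective r; have [a va] := displacement_invariant xi h.
  by exists a => g gh; rewrite va; exact: displacement_phi.
pose l r := projT1 (cid (l_ex r)).
have lE g : v (l (phi g)) = sgval xi g * g^-1.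
  by rewrite /l; case: cid => a /=; exact.
have lP : cocycle_pred M l.
  apply/asboolP; split=> [|r s].
    apply: invariant_in_G_inj.
    by rewrite -[1 in LHS](gmulf1 (s := phi)) lE aut1 gmulf1 mulgV.
  have [g <-] := it_phi_surjective r; have [h <-] := it_phi_surjective s.
  apply: invariant_in_G_inj; rewrite -it_phiM lE invariant_in_GM invariant_in_G_act !lE.
  by rewrite autM invgM !mulgA mulgVK.
by exists (Cocycle lP); apply/val_inj/autP => g; rewrite /= /twist /= lE mulgVK.
Qed.

Lemma star_bijective : bijective star.
Proof. exact: inj_surj_bijective star_injective star_surjective. Qed.

(** * Coboundaries *)

(** If l is the coboundary of a then twisting by l sends g to
    v(a)^-1 (g v(a) g^-1) g, which is conjugation by v(a)^-1. In the other
    direction the conjugating element centralizes j(N), hence comes from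
    Z(K)^P. *)
Lemma star_inner l :
  (exists k, sgval (star l) = inner (i k)) <-> l \in B1 M.
Proof.
split=> [[k lk]|/asboolP[a la]].
  have lkE g : twist l g = i k * g * (i k)^-1.
    by have /(congr1 (fun xi : aut G => xi g)) := lk.
  have /invariant_in_GP[a va] : forall n, commute (i k) (j n).
    move=> n; have /asboolP[starj _] := sgvalP (star l).
    by have := lkE (j n); rewrite [LHS]starj /commute => {2}->; rewrite mulgVK.
  apply/asboolP; exists a^-1 => r; have [g <-] := it_phi_surjective r.
  apply/invariant_in_G_inj/(mulIg g); rewrite -/(twist l g) lkE.
  by rewrite invgK invariant_in_GM invariant_in_G_act invariant_in_GV va !mulgA mulgVK.
exists (sgval (sgval a))^-1; apply: autP => g; rewrite /= /twist la.
by rewrite invariant_in_GM invariant_in_G_act invariant_in_GV !gmulfV invgK !mulgA mulgVK.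
Qed.

End Star.

Theorem corollary4p5 (K N P Q R : groupType)
    (PQR : extension P Q R) (theta : hom Q (out K)) (KNP : extension K N P)
    (G : groupType) (E : iterated_extension KNP PQR G)
    (E_theta : outer_action (Q_main E) =1 theta) :
  exists star : hom (Z1 (Z_K_P_module theta PQR)) (Aut_KNGQR E),
  [/\ bijective star,
      forall lambda g, sgval (star lambda) g =
        it_i E (sgval (sgval (lambda (it_phi E g)))) * g
    & exists star_bar : hom (H1 (Z_K_P_module theta PQR)) (Out_KNGQR E),
        bijective star_bar /\
        forall lambda, sgval (star_bar (class_of (B1 (Z_K_P_module theta PQR)) lambda)) =
          class_of (inner_K E) (Aut_KNGQR_incl (star lambda))].
Proof.
exists (star E_theta); split=> //; first exact: star_bijective.
pose f : hom (Z1 _) (Out_KNGQR E) := @Out_class _ _ _ _ _ _ _ _ E \o star E_theta.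
have [l|y|fbar [fbar_bij fbarE]] := @first_isomorphism _ _ (B1 _) f.
- by rewrite Out_class_eq1 star_inner.
- have [xi <-] := Out_class_surjective y.
  by have [l <-] := star_surjective E_theta xi; exists l.
by exists fbar; split=> // l; rewrite fbarE.
Qed.
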